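(* Let $G$ be a connected planar graph (loops and multiple edges allowed) associated to a link shadow $D$, and let $v$ and $e$ denote the number of vertices and edges of $G$, respectively. If $e$ is odd and either $e>2v-1$ or $e<2(v-1)-1$, then $D$ is an $L$-position shadow for the Link Smoothing Game; that is, player $L$ can guarantee a win regardless of whether $L$ moves first or second.
   Context: A link shadow $D$ is a connected link diagram in which under/over information is unspecified at the crossings (called precrossings). Link Smoothing Game on $D$: two players, $K$ (Knot) and $L$ (Link), alternately select a remaining precrossing and replace it by either of its two smoothings (horizontal or vertical), until no precrossings remain. $K$ wins if the final diagram is connected; $L$ wins if it is disconnected (once disconnected, the diagram stays disconnected). Graph of a shadow: checkerboard color the regions of $D$; the (black) graph $G$ has one vertex per black region and one edge per precrossing, joining the black regions meeting there (loops and multi-edges allowed). $G$ is a connected plane graph; the white graph is its planar dual $G^*$. Every connected plane graph arises in this way. Smoothing a precrossing amounts to either deleting the corresponding edge of $G$ (and contracting the dual edge in $G^*$) or contracting it in $G$ (and deleting the dual edge in $G^*$). The shadow is connected if and only if both graphs are connected. Thus, on $G$, players alternately choose a remaining edge and delete or contract it; $L$ wins as soon as a cut edge is deleted or a loop is contracted (the latter deletes a cut edge of the dual), and $K$ wins if all edges are used up without this ever happening. $L$-position means that $L$ has a winning strategy both when moving first and when moving second. *)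

(* Defs.v *)
(* MathComp *)
From mathcomp Require Import all_boot all_fingroup.

Set Implicit Arguments.
Unset Strict Implicit.
Unset Printing Implicit Defensive.

(** * Link shadows

A shadow with at least one precrossing is encoded as a 4-regular map on the
sphere.  Each precrossing [x] has four strand ends (darts) [(x, i)],
[i : 'I_4], numbered counterclockwise, and [arc] sends a dart to the other end
of the strand of the diagram it starts.  The dart [d] also names the corner
swept counterclockwise from [d] to [turn d]. *)

Definition dart (X : finType) : finType := (X * 'I_4)%type.

Definition turn_fun (X : finType) (d : dart X) : dart X := (d.1, ordS d.2).

Lemma turn_inj (X : finType) : injective (@turn_fun X).
Proof. by move=> [x i] [y j] [-> ij]; congr (_, _); apply: ordS_inj; apply: val_inj. Qed.

Definition turn (X : finType) : {perm dart X} := perm (@turn_inj X).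

(** Regions are the orbits of [next_corner]: leaving along [d] with the corner
[d] on the left, one reaches [arc d], and the corner on the left is then the
one that ends, counterclockwise, at [arc d]. *)
Definition next_corner (X : finType) (arc : {perm dart X}) : {perm dart X} :=
  (arc * (turn X)^-1)%g.

Definition regions (X : finType) (arc : {perm dart X}) : {set {set dart X}} :=
  porbits (next_corner arc).

(** The two smoothings of a precrossing: [Horizontal] joins the ends 0-1 and
2-3, [Vertical] joins 1-2 and 3-0. *)
Inductive smoothing := Horizontal | Vertical.

Definition partner (s : smoothing) (i : 'I_4) : 'I_4 :=
  match s with
  | Horizontal => if odd i then ord_pred i else ordS i
  | Vertical => if odd i then ordS i else ord_pred i
  end.

(** A partially smoothed diagram; [None] marks a remaining precrossing. *)
Definition smoothings (X : finType) := {ffun X -> option smoothing}.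

Definition unsmoothed (X : finType) : smoothings X := [ffun=> None].

(** Two darts are adjacent if they are the ends of one strand, or if they meet
at a common vertex: any two ends at a remaining precrossing, and the two ends
joined by the smoothing at a smoothed one. *)
Definition touching (X : finType) (arc : {perm dart X}) (P : smoothings X) :
    rel (dart X) :=
  fun d d' =>
    (d' == arc d) ||
    (d'.1 == d.1) && (if P d.1 is Some s then d'.2 == partner s d.2 else true).

Definition diagram_connected (X : finType) (arc : {perm dart X})
    (P : smoothings X) : Prop :=
  forall d d', connect (touching arc P) d d'.

(** [shadow_euler] is V + F = E + 2, which for a connected map says that the
surface is the sphere; it also rules out an empty set of precrossings. *)
Record link_shadow := LinkShadow {
  crossing : finType;
  arc : {perm dart crossing};
  arc_involutive : involutive arc;
  arc_neq : forall d, arc d != d;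
  shadow_connected : diagram_connected arc (unsmoothed crossing);
  shadow_euler : #|crossing| + #|regions arc| = #|porbits arc| + 2
}.

(** * The checkerboard graph *)

(** The ends of an edge form a set with one (loop) or two vertices. *)
Record multigraph := Multigraph {
  vertex : finType;
  edge : finType;
  ends : edge -> {set vertex}
}.

Definition multigraph_iso (G H : multigraph) : Prop :=
  exists (f : vertex G -> vertex H) (g : edge G -> edge H),
    [/\ bijective f, bijective g & forall a, ends (g a) = f @: ends a].

(** [black d] is the colour of the region containing the corner [d].  The
corners [d] and [turn d] lie on the two sides of the strand at [turn d]. *)
Definition checkerboard (D : link_shadow) (black : pred (dart (crossing D))) :
    Prop :=
  (forall d, black (next_corner (arc D) d) = black d) /\
  (forall d, black (turn (crossing D) d) = ~~ black d).

Definition black_regions (D : link_shadow) (black : pred (dart (crossing D))) :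
    {set {set dart (crossing D)}} :=
  [set F in regions (arc D) | F \subset black].

Definition black_region (D : link_shadow) (black : pred (dart (crossing D))) :
    finType :=
  {F : {set dart (crossing D)} | F \in black_regions black}.

Definition black_graph (D : link_shadow) (black : pred (dart (crossing D))) :
    multigraph :=
  @Multigraph (black_region black) (crossing D)
    (fun x => [set F : black_region black |
                [exists i : 'I_4, (x, i) \in sval F]]).

Definition graph_of_shadow (G : multigraph) (D : link_shadow) : Prop :=
  exists black : pred (dart (crossing D)),
    checkerboard black /\ multigraph_iso G (black_graph black).

(** * The Link Smoothing Game *)

Inductive player := Knot | Link.

Definition position (D : link_shadow) := smoothings (crossing D).

Definition move (D : link_shadow) := (crossing D * smoothing)%type.

Definition legal (D : link_shadow) (P : position D) (m : move D) : Prop :=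
  P m.1 = None.

Definition play (D : link_shadow) (P : position D) (m : move D) : position D :=
  [ffun x => if x == m.1 then Some m.2 else P x].

Definition game_over (D : link_shadow) (P : position D) : Prop :=
  forall x, P x <> None.

Definition strategy (D : link_shadow) := position D -> move D.

(** [reachable S first p P]: when [first] starts and Link follows [S], some
play of Knot leads to the position [P] with [p] to move. *)
Inductive reachable (D : link_shadow) (S : strategy D) (first : player) :
    player -> position D -> Prop :=
| Reach_start : reachable S first first (unsmoothed (crossing D))
| Reach_Link P :
    reachable S first Link P -> legal P (S P) ->
    reachable S first Knot (play P (S P))
| Reach_Knot P m :
    reachable S first Knot P -> legal P m ->
    reachable S first Link (play P m).

Definition Link_winning_strategy (D : link_shadow) (first : player)
    (S : strategy D) : Prop :=
  forall p P, reachable S first p P ->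
    (p = Link -> ~ game_over P -> legal P (S P)) /\
    (game_over P -> ~ diagram_connected (arc D) P).

Definition L_position (D : link_shadow) : Prop :=
  forall first : player, exists S, @Link_winning_strategy D first S.

(* Main.v *)
(** Link answers every time with the same kind of move, contracting if the
graph has many edges and deleting if it has few.  If the final diagram is
connected, then the contracted crossings connect the [v] black regions, so
there are at least [v - 1] of them; dually the deleted ones connect the
[e + 2 - v] white regions (Euler), so there are exactly [v - 1] contracted
crossings.  As Link makes at least [(e - 1) / 2] of the moves, the hypothesis on
[e] contradicts this count. *)

Require Import Defs.
From mathcomp Require Import all_boot all_algebra.
From mathcomp Require Import all_fingroup zify.

Set Implicit Arguments.
Unset Strict Implicit.
Unset Printing Implicit Defensive.

(* Gluing along one pair loses at most one point, so a quotient by [n] pairs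
keeps at least [#|A| - n] classes. *)
Lemma card_merge (T : finType) (A : {set T}) (es : seq (T * T)) :
  exists f : T -> T, (forall p, p \in es -> f p.1 = f p.2) /\
    #|A| <= #|f @: A| + size es.
Proof.
elim: es => [|[a b] es [f [fE leA]]].
  by exists id; split=> //; rewrite imset_id addn0.
exists (fun x => if f x == f a then f b else f x); split=> [p|].
  rewrite inE => /predU1P [-> /=|/fE ->//]; rewrite eqxx; by case: eqP.
set g := fun x => _.
have sub : f @: A \subset f a |: g @: A.
  apply/subsetP=> _ /imsetP [x xA ->]; rewrite !inE.
  case: eqP => //= /eqP nfx; apply/imsetP; exists x => //.
  by rewrite /g (negbTE nfx).
move: (subset_leq_card sub) leA; rewrite cardsU1 /=; case: (_ \notin _) => /=; lia.
Qed.

(** Orbits are pairs [{x, s x}]. Applied to [arc], this counts two strands per precrossing. *)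
Lemma card_porbits_involutive (T : finType) (s : {perm T}) :
  involutive s -> (forall x, s x != x) -> #|porbits s| * 2 = #|T|.
Proof.
move=> sK sN; rewrite -cardsT; apply/esym.
have -> : porbits s = equivalence_partition (fun x y => y \in porbit s x) setT.
  apply/setP=> F; apply/imsetP/imsetP => -[x _ ->]; exists x => //;
  by apply/setP=> y; rewrite !inE.
apply: (@card_uniform_partition _ 2); last first.
  apply: equivalence_partitionP => x y z _ _ _; split; first exact: porbit_id.
  by move=> xy; apply/idP/idP; move: xy; rewrite -!eq_porbit_mem => /eqP ->.
move=> _ /imsetP [x _ ->].
have -> : [set y in setT | y \in porbit s x] = [set x; s x].
  apply/setP=> y; rewrite !inE /=; apply/porbitP/pred2P => [[i ->]|].
    elim: i => [|i [] IH]; first by left; rewrite perm1.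
      by right; rewrite expgSr permM IH.
    by left; rewrite expgSr permM IH sK.
  by case=> ->; [exists 0; rewrite perm1 | exists 1; rewrite expg1].
by rewrite cards2 eq_sym sN.
Qed.

(** * Black regions along a connected final diagram *)

Section Coloured.
Variables (D : link_shadow) (black : pred (dart (crossing D))).
Hypothesis cb : checkerboard black.

Let nc := next_corner (Defs.arc D).
Let rot := turn (crossing D).

Definition white : pred (dart (crossing D)) := predC black.

Lemma checkerboard_white : checkerboard white.
Proof. by case: cb => cb1 cb2; split=> d; rewrite /white /= ?cb1 ?cb2. Qed.

Lemma black_turnV d : black (rot^-1%g d) = ~~ black d.
Proof. by case: cb => _ /(_ (rot^-1%g d)); rewrite permKV => ->; rewrite negbK. Qed.

Lemma black_porbit d d' : d' \in porbit nc d -> black d' = black d.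
Proof.
case: cb => cb1 _ /porbitP [i ->]; elim: i => [|i IH]; first by rewrite perm1.
by rewrite expgSr permM cb1.
Qed.

Lemma black_regionsE :
  black_regions black = [set porbit nc d | d in [set d | black d]].
Proof.
apply/setP=> F; rewrite inE; apply/andP/imsetP => [[/imsetP [d _ ->] /subsetP sF]|[d]].
  by exists d => //; rewrite inE; apply: sF (porbit_id _ _).
rewrite inE => bd ->; split; first exact: imset_f.
by apply/subsetP=> d' /black_porbit; rewrite bd.
Qed.

(* The corners [d] and [turn^-1 d] lie on the two sides of the strand at [d], and
exactly one of them is black. *)
Definition black_side d := porbit nc (if black d then d else rot^-1%g d).

(** [arc] flips the colour, so the black corners beside the two ends of a strand are consecutive
    under [next_corner]. *)
Lemma black_side_arc d : black_side (Defs.arc D d) = black_side d.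
Proof.
have ncE d' : nc d' = rot^-1%g (Defs.arc D d') by rewrite /nc /next_corner permM.
have bA d' : black (Defs.arc D d') = ~~ black d'.
  by case: cb => /(_ d') <- _; rewrite -/nc ncE black_turnV negbK.
have oE d' : porbit nc (nc d') = porbit nc d'.
  by apply/eqP; rewrite eq_sym eq_porbit_mem -(expg1 nc) porbit_sym mem_porbit.
rewrite /black_side bA; case: (black d) => /=; first by rewrite -ncE oE.
by rewrite -oE ncE arc_involutive.
Qed.

Definition horizontal (s : smoothing) : bool :=
  if s is Horizontal then true else false.

(** With [h := black_merge black] these are the contracted edges of the black graph, with the
    negation the deleted ones. *)
Definition chosen (h : crossing D -> bool) (P : position D) : {set crossing D} :=
  [set x | if P x is Some s then horizontal s == h x else false].

(* [Horizontal] cuts off the corners 0 and 2 and merges the corners 1 and 3. *)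
Definition black_merge x := ~~ black (x, ord0).

Lemma black_corner x (i : 'I_4) : black (x, i) = odd i (+) black (x, ord0).
Proof.
have E (j : 'I_4) : black (x, ordS j) = ~~ black (x, j).
  by case: cb => _ /(_ (x, j)); rewrite /turn permE.
have nE (k : 'I_4) (j : 'I_4): val k = val (ordS j) -> black (x, k) = ~~ black (x, j).
  by move=> kj; rewrite -E; congr (black (_, _)); apply: val_inj.
case: i => -[|[|[|[|//]]]] p.
- by congr (black (_, _)); apply: val_inj.
- by rewrite (@nE _ ord0).
- by rewrite (@nE _ (@Ordinal 4 1 isT)) // (@nE _ ord0) // negbK.
- rewrite (@nE _ (@Ordinal 4 2 isT)) // (@nE _ (@Ordinal 4 1 isT)) //.
  by rewrite (@nE _ ord0) // negbK.
Qed.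

Lemma turnV_pair x i : rot^-1%g (x, i) = (x, ord_pred i).
Proof.
by apply: (@perm_inj _ rot); rewrite permKV /rot /turn permE /turn_fun /= ord_predK.
Qed.

(** Whatever the colour of corner 0, the ends 0 and 2 border the two different black corners at
    [x]. *)
Definition black_edge x :=
  (black_side (x, ord0), black_side (x, ordS (ordS ord0))).

Lemma black_side_partner (f : {set dart (crossing D)} -> {set dart (crossing D)})
    x s i :
  (horizontal s == black_merge x -> f (black_edge x).1 = f (black_edge x).2) ->
  f (black_side (x, partner s i)) = f (black_side (x, i)).
Proof.
(* With corners named by numbers, each of the 16 cases holds by computation or
by the hypothesis. *)
have sideE (j : 'I_4) : f (black_side (x, j)) =
    f (porbit nc (x, inord (if odd j (+) black (x, ord0) then j : nat
                            else ord_pred j))).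
  by rewrite /black_side turnV_pair (black_corner x j); case: ifP => _; rewrite inord_val.
rewrite /black_edge /black_merge !sideE.
case: s => /=; case: (black _) => /= fE; case: i => -[|[|[|[|//]]]] p;
  first [by [] | exact: fE | exact: esym (fE _)].
Qed.

(** Walking along the diagram, the black region alongside changes only at a contracted edge, so
    these edges span a connected graph on the black regions. *)
Lemma black_regions_connected P :
  diagram_connected (Defs.arc D) P -> game_over P ->
  #|black_regions black| <= #|chosen black_merge P|.+1.
Proof.
move=> conn over; pose C := chosen black_merge P.
(* [f] glues the ends of every contracted edge; it remains to see that a single class is left. *)
have [f [fE leA]] := card_merge (black_regions black) [seq black_edge x | x in C].
apply: leq_trans leA _; rewrite size_map -cardE -add1n leq_add2r.
have fC d d' : connect (touching (Defs.arc D) P) d d' -> f (black_side d') = f (black_side d).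
  case/connectP=> p + ->; elim: p d => //= d1 p IH d /andP [t /IH ->].
  case/orP: t => [/eqP ->|]; first by rewrite black_side_arc.
  case: d1 d {IH} => x1 i1 [x i] /= /andP [/eqP ->].
  case Px: (P x) => [s|]; last by case: (over x).
  move/eqP=> ->; apply: black_side_partner => sx; apply: fE.
  by apply: image_f; rewrite inE Px.
apply/card_le1P => _ /imsetP [F AF ->].
move: AF; rewrite black_regionsE => /imsetP [d]; rewrite inE => bd ->.
move=> y; rewrite inE; apply/imsetP/eqP => [[F' ]|->]; last first.
  by exists (porbit nc d) => //; apply: imset_f; rewrite inE.
case/imsetP=> d'; rewrite inE => bd' -> ->.
by have:= fC d d' (conn d d'); rewrite /black_side bd bd'.
Qed.

End Coloured.

(** * Euler's formula and the exact number of contractions *)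

Section Counting.
Variables (D : link_shadow) (black : pred (dart (crossing D))).
Hypothesis cb : checkerboard black.

Lemma card_black_white :
  #|black_regions black| + #|black_regions (white black)| = #|crossing D| + 2.
Proof.
have/eqP := shadow_euler D.
have := card_porbits_involutive (@arc_involutive D) (@arc_neq D).
rewrite card_prod card_ord => arcE.
have -> : regions (Defs.arc D) = black_regions black :|: black_regions (white black).
  apply/setP=> F; rewrite !inE -andb_orr andb_idr // => /imsetP [d _ ->].
  case bd: (black d); apply/orP; [left|right]; apply/subsetP=> d' /(black_porbit cb).
    by rewrite bd.
  by rewrite bd => d'E; rewrite inE /= d'E.
rewrite cardsU; have -> : black_regions black :&: black_regions (white black) = set0.
  apply/setP=> F; rewrite !inE; apply/negP.
  case/andP=> /andP [/imsetP [d _ ->] /subsetP s1] /andP [_ /subsetP s2].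
  exact: negP (s2 d (porbit_id _ _)) (s1 d (porbit_id _ _)).
rewrite cards0 => /eqP; lia.
Qed.

Lemma card_chosen_compl (h : crossing D -> bool) P : game_over P ->
  #|chosen h P| + #|chosen (fun x => ~~ h x) P| = #|crossing D|.
Proof.
move=> over; rewrite -(cardC [in chosen h P]); congr (_ + _); apply: eq_card => x.
rewrite !inE; case Px: (P x) => [s|]; last by case: (over x).
by case: horizontal (h x) => -[].
Qed.

(** The lower bounds for black and for white add up, by Euler, to the number of precrossings, so
    both are equalities. *)
Lemma connected_card_merged P : diagram_connected (Defs.arc D) P -> game_over P ->
  #|chosen (black_merge black) P|.+1 = #|black_regions black|.
Proof.
move=> conn over.
have := black_regions_connected cb conn over.
have := black_regions_connected (checkerboard_white cb) conn over.
have := card_chosen_compl (black_merge black) over; have := card_black_white.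
(* Merging the white corners at a precrossing is the smoothing that does not merge the black
   ones. *)
have -> : #|chosen (black_merge (white black)) P| =
          #|chosen (fun x => ~~ black_merge black x) P| by [].
lia.
Qed.

End Counting.

(** * Link's strategy of always making the same kind of move *)

Section Persistence.
Variables (D : link_shadow) (x0 : crossing D) (h : crossing D -> bool).

(** The default [x0] is returned only when no precrossing remains. *)
Definition persistent : strategy D := fun P =>
  let x := odflt x0 [pick x | ~~ isSome (P x)] in
  (x, if h x then Horizontal else Vertical).

Definition smoothed (P : position D) : {set crossing D} := [set x | isSome (P x)].

Lemma persistent_legal P : ~ game_over P -> legal P (persistent P).
Proof.
rewrite /legal /=; case: pickP => [x /=|none []]; first by case: (P x).
by move=> x Px; have := none x; rewrite Px.
Qed.

Lemma card_smoothed_play P m : legal P m ->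
  #|smoothed (play P m)| = #|smoothed P|.+1.
Proof.
move=> lm; have -> : smoothed (play P m) = m.1 |: smoothed P.
  by apply/setP=> x; rewrite !inE ffunE; case: eqP.
by rewrite cardsU1 inE lm.
Qed.

Lemma chosen_play P m : legal P m ->
  #|chosen h (play P m)| = #|chosen h P| + (horizontal m.2 == h m.1).
Proof.
move=> lm; have mP : m.1 \notin chosen h P by rewrite inE lm.
have -> : chosen h (play P m) =
    if horizontal m.2 == h m.1 then m.1 |: chosen h P else chosen h P.
  by case: ifP => hm; apply/setP=> x; rewrite !inE ffunE;
    case: (x =P m.1) => //= ->; rewrite ?hm // lm.
case: (horizontal m.2 == h m.1); last by rewrite addn0.
by rewrite cardsU1 mP addnC.
Qed.

(** After l moves of Link, alternation gives 2l + [first = Knot] - [p = Knot] smoothed precrossings;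
    Knot's moves can only add to [chosen]. *)
Lemma reachable_chosen first p P : reachable persistent first p P ->
  #|smoothed P| + (if p is Knot then 1 else 0)
    <= 2 * #|chosen h P| + (if first is Knot then 1 else 0).
Proof.
elim=> [|{}P _ IH lP|{}P m _ IH lm].
- have -> : smoothed (unsmoothed (crossing D)) = set0.
    by apply/setP=> x; rewrite !inE ffunE.
  by rewrite cards0; case: first; rewrite leq_addl.
- rewrite card_smoothed_play // chosen_play //=.
  have -> : horizontal (persistent P).2 == h (persistent P).1.
    by rewrite /=; case: (h _).
  by move: IH; lia.
- rewrite card_smoothed_play // chosen_play //; move: IH; lia.
Qed.

Lemma persistent_half first p P : reachable persistent first p P ->
  game_over P -> #|crossing D| <= 2 * #|chosen h P| + 1.
Proof.
move=> /reachable_chosen rP over; rewrite -cardsT.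
have -> : setT = smoothed P.
  by apply/setP=> x; rewrite !inE; case Px: (P x) => //; case: (over x).
by move: rP; case: first; lia.
Qed.

End Persistence.

Theorem corollary7 (D : link_shadow) (G : multigraph) (v e : nat)
    (hG : graph_of_shadow G D)
    (hv : v = #|vertex G|) (he : e = #|edge G|)
    (hodd : odd e)
    (hineq : (2 * v%:Z - 1 < e%:Z)%R \/ (e%:Z < 2 * (v%:Z - 1) - 1)%R) :
  L_position D.
Proof.
case: hG => black [cb [f [g [/bij_eq_card fv /bij_eq_card ge _]]]].
rewrite fv card_sig in hv; rewrite ge in he.
have {}hv : v = #|black_regions black| by rewrite hv; apply: eq_card.
have [x0 _] : exists x : crossing D, x \in predT.
  by apply/card_gt0P; rewrite -[X in 0 < X]he; case: (e) hodd.
move=> first; case: hineq => ineq.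
  (* Link contracts: exactly v - 1 contractions would force e <= 2(v - 1) + 1 = 2v - 1. *)
  exists (persistent x0 (black_merge black)) => p P reach.
  split=> [_|over conn]; first exact: persistent_legal.
  have := persistent_half reach over; have := connected_card_merged cb conn over.
  by rewrite -hv -he; move: ineq; lia.
(* Link deletes: exactly e - (v - 1) deletions would force e <= 2(e - v + 1) + 1, that is e >= 2(v -
   1) - 1. *)
exists (persistent x0 (fun x => ~~ black_merge black x)) => p P reach.
split=> [_|over conn]; first exact: persistent_legal.
have := persistent_half reach over; have := connected_card_merged cb conn over.
have := card_chosen_compl (black_merge black) over.
by rewrite -hv -he; move: ineq; lia.
Qed.
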